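(* Let $V>0$ and let $\{x(t),y(t),w(t),z(t)\}_{t=0}^\infty$ be any sequence generated by the dual subgradient algorithm with parameter $V$ (described in the context), with $\lambda(t)=(w(t),z(t))$. For every integer $T>0$, letting $\bar x(T)=\frac1T\sum_{t=0}^{T-1}x(t)$, $$f(\bar x(T))-f^{(\mathrm{opt})}\le \frac{V}{2T}\left[\|\lambda(0)\|^2-\|\lambda(T)\|^2\right]+\frac{C}{V}+\frac{VM}{T}\|z(T)-z(0)\|,$$ and, for every $j\in\{1,\dots,J\}$, $$g_j(\bar x(T))\le \frac{V}{T}\,|w_j(T)-w_j(0)|+\frac{VM}{T}\|z(T)-z(0)\|.$$
   Context: Setting. $I,J$ are positive integers. $\mathcal X\subset\mathbb R^I$ is a nonempty closed bounded set (possibly non-convex or discrete) and $\overline{\mathcal X}$ is its convex hull. $\mathcal Y\subset\mathbb R^I$ is closed, bounded, convex and contains $\overline{\mathcal X}$. The functions $f,g_1,\dots,g_J:\mathcal Y\to\mathbb R$ are convex and Lipschitz continuous with a common constant $M>0$: $|f(x)-f(y)|\le M\|x-y\|$ and $|g_j(x)-g_j(y)|\le M\|x-y\|$ for all $x,y\in\mathcal Y$ (all norms are Euclidean). Write $g(y)=(g_1(y),\dots,g_J(y))$. $C>0$ is a constant with $\|g(y)\|^2\le C$ and $\|x-y\|^2\le C$ for all $x\in\overline{\mathcal X}$, $y\in\mathcal Y$. $f^{(\mathrm{opt})}$ is the optimal value of: minimize $f(x)$ subject to $g_j(x)\le 0$ for $j=1,\dots,J$ and $x\in\overline{\mathcal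 X}$ (equivalently, of: minimize $f(y)$ subject to $g_j(y)\le 0$ for all $j$, $x=y$, $x\in\overline{\mathcal X}$, $y\in\mathcal Y$). Slater condition (standing assumption): there is $\hat x\in\overline{\mathcal X}$, lying in the interior of $\mathcal Y$, with $g_j(\hat x)<0$ for all $j$. Dual subgradient algorithm with parameter $V>0$: start from any $w(0)\in\mathbb R_+^J$, $z(0)\in\mathbb R^I$ ($\mathbb R_+=[0,\infty)$). For $t=0,1,2,\dots$: choose $x(t)\in\mathcal X$ minimizing $x\mapsto z(t)^\top x$ over $\overline{\mathcal X}$; choose $y(t)\in\mathcal Y$ minimizing $y\mapsto f(y)+w(t)^\top g(y)-z(t)^\top y$ over $\mathcal Y$; set $w(t+1)=[w(t)+\frac1V g(y(t))]_+$ (componentwise positive part) and $z(t+1)=z(t)+\frac1V[x(t)-y(t)]$. *)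

(* Defs.v *)
From HB Require Import structures.
From mathcomp Require Import all_boot all_order all_algebra.
From mathcomp Require Import all_classical all_reals all_analysis.

Set Implicit Arguments.
Unset Strict Implicit.
Unset Printing Implicit Defensive.

Import Order.TTheory GRing.Theory Num.Theory.
Import numFieldNormedType.Exports.

Local Open Scope classical_set_scope.
Local Open Scope ring_scope.

Definition dot (R : realType) (n : nat) (u v : 'rV[R]_n) : R :=
  (u *m v^T) 0 0.

(* The library norm `|v| on 'rV[R]_n is the sup norm, hence this separate
   Euclidean norm. Both induce the same topology and the same bounded sets, so
   closed, interior and bounded_set need no Euclidean counterpart. *)
Definition norm2 (R : realType) (n : nat) (v : 'rV[R]_n) : R :=
  Num.sqrt (\sum_(i < n) v 0 i ^+ 2).

Definition conv_hull (R : realType) (n : nat) (A : set 'rV[R]_n) :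
    set 'rV[R]_n :=
  smallest [set B : set 'rV[R]_n | convex_set B] A.

Definition is_minimizer (R : realType) (E : Type) (h : E -> R) (A : set E)
    (a : E) : Prop :=
  A a /\ forall b, A b -> h a <= h b.

Definition feasible (R : realType) (n k : nat) (D : set 'rV[R]_n)
    (g : 'rV[R]_n -> 'rV[R]_k) : set 'rV[R]_n :=
  [set x | D x /\ forall j, g x 0 j <= 0].

(* inf is the real infimum, which is 0 by convention when the set of values is
   empty or unbounded below. *)
Definition opt_value (R : realType) (n k : nat) (D : set 'rV[R]_n)
    (f : 'rV[R]_n -> R) (g : 'rV[R]_n -> 'rV[R]_k) : R :=
  inf (f @` feasible D g).

(* x t lies in X itself, while its minimality is over the convex hull of X. *)
Definition dual_subgradient (R : realType) (n k : nat) (X Y : set 'rV[R]_n)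
    (f : 'rV[R]_n -> R) (g : 'rV[R]_n -> 'rV[R]_k) (V : R)
    (x y : nat -> 'rV[R]_n) (w : nat -> 'rV[R]_k) (z : nat -> 'rV[R]_n) :
    Prop :=
  (forall j, 0 <= w 0%N 0 j) /\
  forall t : nat,
    [/\ X (x t) /\ is_minimizer (fun u => dot (z t) u) (conv_hull X) (x t),
        is_minimizer (fun u => f u + dot (w t) (g u) - dot (z t) u) Y (y t),
        w t.+1 = map_mx (Num.max 0) (w t + V^-1 *: g (y t)) &
        z t.+1 = z t + V^-1 *: (x t - y t)].

(* Main.v *)
(** By minimality of [x t] and [y t], the drift of [norm2 (lambda t) ^+ 2 / 2]
   along one step, times [V], is at most [f u - f (y t) + C / V] for every
   feasible [u]; summing telescopes, and Jensen's inequality gives the bounds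
   for the average of the [y t]. The recursion for [z] says that the averages
   of the [x t] and of the [y t] differ by [(V / T%:R) *: (z T - z 0)], so the
   Lipschitz condition transfers the bounds to the average of the [x t]. *)

Require Import Defs.
From HB Require Import structures.
From mathcomp Require Import all_boot all_order all_algebra.
From mathcomp Require Import all_classical all_reals all_analysis.
From mathcomp Require Import ring lra.
Import Order.TTheory GRing.Theory Num.Theory.
Import numFieldNormedType.Exports.
Local Open Scope classical_set_scope.
Local Open Scope ring_scope.

Set Implicit Arguments.
Unset Strict Implicit.

Lemma eq_ler (R : numDomainType) (a b : R) : a = b -> a <= b.
Proof. by move=> ->. Qed.

(** * Euclidean inner product and norm *)

Section Euclid.
Context {R : realType} {n : nat}.
Implicit Types (u v : 'rV[R]_n) (a : R).

Lemma dotE u v : dot u v = \sum_(i < n) u 0 i * v 0 i.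
Proof. by rewrite /dot mxE; apply: eq_bigr => i _; rewrite mxE. Qed.

Lemma dotBr u v v' : dot u (v - v') = dot u v - dot u v'.
Proof. by rewrite /dot linearB/= mulmxBr !mxE. Qed.

Lemma norm2_sqr v : norm2 v ^+ 2 = \sum_(i < n) v 0 i ^+ 2.
Proof. by rewrite /norm2 sqr_sqrtr// sumr_ge0// => i _; rewrite sqr_ge0. Qed.

Lemma norm2_sqrDZ u a v :
  norm2 (u + a *: v) ^+ 2 = norm2 u ^+ 2 + 2 * a * dot u v + a ^+ 2 * norm2 v ^+ 2.
Proof.
rewrite !norm2_sqr dotE !mulr_sumr -!big_split/=.
by apply: eq_bigr => i _; rewrite !mxE; ring.
Qed.

Lemma norm2Z a v : 0 <= a -> norm2 (a *: v) = a * norm2 v.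
Proof.
move=> a0; apply/eqP; rewrite -(eqrXn2 (ltn0Sn 1)) ?mulr_ge0 ?sqrtr_ge0//.
rewrite exprMn !norm2_sqr mulr_sumr.
by apply/eqP/eq_bigr => i _; rewrite mxE exprMn.
Qed.

(** Taking the positive part only shrinks each coordinate in absolute value; this removes the
    truncation in the update of [w] from the drift estimate. *)
Lemma norm2_sqr_pos_part v : norm2 (map_mx (Num.max 0) v) ^+ 2 <= norm2 v ^+ 2.
Proof.
rewrite !norm2_sqr; apply: ler_sum => i _; rewrite mxE.
by case: (leP 0 (v 0 i)) => // _; rewrite expr0n sqr_ge0.
Qed.

End Euclid.

Lemma norm2_sqr_row_mx (R : realType) (m n : nat) (u : 'rV[R]_m) (v : 'rV[R]_n) :
  norm2 (row_mx u v) ^+ 2 = norm2 u ^+ 2 + norm2 v ^+ 2.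
Proof.
rewrite !norm2_sqr big_split_ord/=.
by congr (_ + _); apply: eq_bigr => i _; rewrite ?row_mxEl ?row_mxEr.
Qed.

(** * Time averages and Jensen's inequality *)

Section Averages.
Context {R : realType}.

(** Any module is allowed, so that the same telescoping serves vectors and, through [R^o], real
    values. *)
Definition average {E : lmodType R} (T : nat) (p : nat -> E) : E :=
  T%:R^-1 *: \sum_(0 <= t < T) p t.

(** This two-point convex combination drives the inductions on the number of terms below. *)
Lemma averageS (E : lmodType R) (T : nat) (p : nat -> E) : (0 < T)%N ->
  average T.+1 p =
    T.+1%:R^-1 *: p T + (1 - T.+1%:R^-1) *: average T p.
Proof.
move=> T_gt0; have T0 : (T%:R : R) != 0 by rewrite pnatr_eq0 -lt0n.
have T1 : (T.+1%:R : R) != 0 by rewrite pnatr_eq0.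
rewrite /average big_nat_recr//= scalerDr scalerA addrC; congr (_ + _ *: _).
by rewrite -natr1 in T1 *; field; rewrite T0 T1.
Qed.

Lemma averageB (E : lmodType R) (T : nat) (p q : nat -> E) :
  average T p - average T q = average T (fun t => p t - q t).
Proof. by rewrite /average -scalerBr sumrB. Qed.

Lemma average_le (T : nat) (p q : nat -> R^o) :
  (forall t, p t <= q t) -> average T p <= average T q.
Proof.
move=> pq; rewrite /average; apply: ler_wpM2l; first by rewrite invr_ge0.
by apply: ler_sum => t _.
Qed.

Lemma average_telescope (E : lmodType R) (T : nat) (p : nat -> E) :
  average T (fun t => p t.+1 - p t) = T%:R^-1 *: (p T - p 0%N).
Proof. by rewrite /average telescope_sumr. Qed.

Section Jensen.
Context {n : nat} (D : set 'rV[R]_n).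

Lemma convex_setP (a : R) (u v : 'rV[R]_n) :
  convex_set D -> 0 <= a -> a <= 1 -> D u -> D v -> D (a *: u + (1 - a) *: v).
Proof.
move=> cD a0 a1 Du Dv.
by have := cD u v (Itv01 a0 a1) (mem_set Du) (mem_set Dv) => /set_mem.
Qed.

Lemma convex_functionP (h : 'rV[R]_n -> R) (a : R) (u v : 'rV[R]_n) :
  convex_function D h -> 0 <= a -> a <= 1 -> D u -> D v ->
  h (a *: u + (1 - a) *: v) <= a * h u + (1 - a) * h v.
Proof.
move=> ch a0 a1 Du Dv.
exact: (ch (Itv01 a0 a1) u v (mem_set Du) (mem_set Dv)).
Qed.

Lemma convex_set_average (T : nat) (p : nat -> 'rV[R]_n) :
  convex_set D -> (forall t, D (p t)) -> (0 < T)%N -> D (average T p).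
Proof.
(* The induction starts at one term: the empty average is the default [0], which may lie outside
   [D]. *)
move=> cD Dp; elim: T => // -[_ _|T IH _].
  by rewrite /average big_nat1 invr1 scale1r.
rewrite averageS//; apply: convex_setP => //; last exact: IH.
by rewrite invf_le1 ?ler1n.
Qed.

Lemma jensen_average (h : 'rV[R]_n -> R) (T : nat) (p : nat -> 'rV[R]_n) :
  convex_set D -> convex_function D h -> (forall t, D (p t)) -> (0 < T)%N ->
  h (average T p) <= average T (h \o p : nat -> R^o).
Proof.
move=> cD ch Dp; elim: T => // -[_ _|T IH _].
  by rewrite /average !big_nat1 invr1 !scale1r.
rewrite [average T.+2 p]averageS// [average T.+2 _]averageS//.
apply: (@le_trans _ _ (T.+2%:R^-1 * h (p T.+1)
                       + (1 - T.+2%:R^-1) * h (average T.+1 p))).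
  apply: (convex_functionP ch) => //; last exact: convex_set_average.
  by rewrite invf_le1 ?ler1n.
rewrite lerD2l; apply: ler_wpM2l; last exact: IH.
by rewrite subr_ge0 invf_le1 ?ler1n.
Qed.

End Jensen.
End Averages.

(** The hull is an intersection of convex sets. *)
Lemma convex_conv_hull (R : realType) (n : nat) (A : set 'rV[R]_n) :
  convex_set (conv_hull A).
Proof.
move=> u v a /set_mem Au /set_mem Av; apply/mem_set => B [cB AB].
apply/set_mem/cB; apply/mem_set.
- exact: Au.
- exact: Av.
Qed.

Lemma sub_conv_hull (R : realType) (n : nat) (A : set 'rV[R]_n) :
  A `<=` conv_hull A.
Proof. exact: sub_gen_smallest. Qed.

(** * One-step and averaged estimates for the algorithm *)

Section Algorithm.
Context {R : realType} {I J : nat} {X Y : set 'rV[R]_I}.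
Context {f : 'rV[R]_I -> R} {g : 'rV[R]_I -> 'rV[R]_J} {M C V : R}.
Context {x y : nat -> 'rV[R]_I} {w : nat -> 'rV[R]_J} {z : nat -> 'rV[R]_I}.
Context (Y_convex : convex_set Y).
Context (hullX_sub_Y : conv_hull X `<=` Y).
Context (V_gt0 : 0 < V).
Context (algo : dual_subgradient X Y f g V x y w z).

Lemma dual_subgradient_X t : conv_hull X (x t).
Proof. by have [_ /(_ t)[[/sub_conv_hull]]] := algo. Qed.

Lemma dual_subgradient_Y t : Y (y t).
Proof. by have [_ /(_ t)[_ []]] := algo. Qed.

Lemma multiplier_ge0 t j : 0 <= w t 0 j.
Proof.
have [w0 step] := algo; case: t => [//|t].
by have [_ _ -> _] := step t; rewrite mxE le_max lexx.
Qed.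

(** The positive part dominates its argument [w t + V^-1 *: g (y t)]. The right-hand side telescopes
    when averaged. *)
Lemma multiplier_step t j : g (y t) 0 j <= V * (w t.+1 0 j - w t 0 j).
Proof.
have [_ /(_ t)[_ _ -> _]] := algo.
rewrite !mxE -ler_pdivrMl// lerBrDl le_max; apply/orP; right.
by rewrite lexx.
Qed.

Lemma average_gap T :
  average T x - average T y = (V / T%:R) *: (z T - z 0%N).
Proof.
rewrite averageB (_ : (fun t => x t - y t) = (fun t => V *: z t.+1 - V *: z t)).
  by rewrite (average_telescope T (fun t => V *: z t)) -scalerBr scalerA mulrC.
apply/funext => t; have [_ /(_ t)[_ _ _ ->]] := algo.
by rewrite scalerDr addrAC subrr add0r scalerA divff ?gt_eqF// scale1r.
Qed.

(** By convexity both averages lie in [Y], so the Lipschitz bound applies to their gap. [h] stands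
    for [f] and for each component of [g]. *)
Lemma lipschitz_average (h : 'rV[R]_I -> R) T : (0 < T)%N ->
  (forall u v, Y u -> Y v -> `|h u - h v| <= M * norm2 (u - v)) ->
  h (average T x) <= h (average T y) + V * M / T%:R * norm2 (z T - z 0%N).
Proof.
move=> T_gt0 lip; rewrite -lerBlDl; apply: le_trans (ler_norm _) _.
have Yx : Y (average T x).
  apply: hullX_sub_Y.
  exact: (convex_set_average (@convex_conv_hull _ _ X) dual_subgradient_X).
have Yy : Y (average T y).
  by apply: convex_set_average => // t; exact: dual_subgradient_Y.
apply: le_trans (lip _ _ Yx Yy) _.
rewrite average_gap norm2Z ?divr_ge0 ?(ltW V_gt0)//.
by apply: eq_ler; ring.
Qed.

Context (g_bound : forall v, Y v -> norm2 (g v) ^+ 2 <= C).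
Context (diff_bound :
  forall u v, conv_hull X u -> Y v -> norm2 (u - v) ^+ 2 <= C).

Let L t := norm2 (row_mx (w t) (z t)) ^+ 2.

(** Expanding the squared norms of both updates gives the inner products as cross terms and two
    second-order terms, each at most [C / V ^+ 2]; after scaling by [V / 2] these add up to
    [C / V]. *)
Lemma drift t : V / 2 * (L t.+1 - L t) <=
  dot (w t) (g (y t)) + dot (z t) (x t - y t) + C / V.
Proof.
have [_ /(_ t)[_ _ wS zS]] := algo.
have Lw : norm2 (w t.+1) ^+ 2 <= norm2 (w t) ^+ 2
    + 2 * V^-1 * dot (w t) (g (y t)) + V^-1 ^+ 2 * C.
  rewrite wS; apply: le_trans (norm2_sqr_pos_part _) _.
  rewrite norm2_sqrDZ lerD2l ler_wpM2l ?sqr_ge0//.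
  exact/g_bound/dual_subgradient_Y.
have Lz : norm2 (z t.+1) ^+ 2 <= norm2 (z t) ^+ 2
    + 2 * V^-1 * dot (z t) (x t - y t) + V^-1 ^+ 2 * C.
  rewrite zS norm2_sqrDZ lerD2l ler_wpM2l ?sqr_ge0//.
  by apply: diff_bound; [exact: dual_subgradient_X|exact: dual_subgradient_Y].
rewrite /L !norm2_sqr_row_mx.
have V2 : 0 <= V / 2 by rewrite divr_ge0// ltW.
have -> : dot (w t) (g (y t)) + dot (z t) (x t - y t) + C / V =
  V / 2 * (2 * V^-1 * dot (w t) (g (y t)) + V^-1 ^+ 2 * C
           + (2 * V^-1 * dot (z t) (x t - y t) + V^-1 ^+ 2 * C)).
  by field; rewrite gt_eqF.
by apply: ler_wpM2l => //; lra.
Qed.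

(** Both minimizers are compared with the same [u], so the two terms [dot (z t) u] cancel; what
    remains, [dot (w t) (g u)], is nonpositive by the signs of [w t] and [g u]. *)
Lemma drift_plus_penalty u t : feasible (conv_hull X) g u ->
  f (y t) <= f u + C / V + V / 2 * (L t - L t.+1).
Proof.
move=> [Xu gu]; have [_ /(_ t)[[_ [_ xmin]] [_ ymin] _ _]] := algo.
have wg : dot (w t) (g u) <= 0.
  rewrite dotE; apply: sumr_le0 => j _.
  by rewrite mulr_ge0_le0// multiplier_ge0.
have := drift t; rewrite dotBr.
have := xmin u Xu; have := ymin u (hullX_sub_Y Xu) => /=; lra.
Qed.

End Algorithm.

Unset Implicit Arguments.
Set Strict Implicit.

Theorem theorem1 (R : realType) (I J : nat) (I_gt0 : (0 < I)%N)
    (J_gt0 : (0 < J)%N) (X Y : set 'rV[R]_I)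
    (f : 'rV[R]_I -> R) (g : 'rV[R]_I -> 'rV[R]_J) (M C : R)
    (X_nonempty : X !=set0) (X_closed : closed X) (X_bounded : bounded_set X)
    (Y_closed : closed Y) (Y_bounded : bounded_set Y)
    (Y_convex : convex_set Y) (hullX_sub_Y : conv_hull X `<=` Y)
    (f_convex : convex_function Y f)
    (g_convex : forall j : 'I_J, convex_function Y (fun u => g u 0 j))
    (M_gt0 : 0 < M)
    (f_lipschitz : forall u v, Y u -> Y v -> `|f u - f v| <= M * norm2 (u - v))
    (g_lipschitz : forall (j : 'I_J) u v, Y u -> Y v ->
      `|g u 0 j - g v 0 j| <= M * norm2 (u - v))
    (C_gt0 : 0 < C)
    (g_bound : forall v, Y v -> norm2 (g v) ^+ 2 <= C)
    (diff_bound : forall u v, conv_hull X u -> Y v -> norm2 (u - v) ^+ 2 <= C)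
    (slater : exists xhat : 'rV[R]_I,
      [/\ conv_hull X xhat, interior Y xhat & forall j, g xhat 0 j < 0])
    (V : R) (V_gt0 : 0 < V)
    (x y : nat -> 'rV[R]_I) (w : nat -> 'rV[R]_J) (z : nat -> 'rV[R]_I)
    (algo : dual_subgradient X Y f g V x y w z)
    (T : nat) (T_gt0 : (0 < T)%N) :
  let lambda t := row_mx (w t) (z t) in
  let xbar := T%:R^-1 *: \sum_(0 <= t < T) x t in
  f xbar - opt_value (conv_hull X) f g
    <= V / (2 * T%:R) * (norm2 (lambda 0%N) ^+ 2 - norm2 (lambda T) ^+ 2)
       + C / V + V * M / T%:R * norm2 (z T - z 0%N)
  /\
  forall j : 'I_J,
    g xbar 0 j
      <= V / T%:R * `|w T 0 j - w 0%N 0 j|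
         + V * M / T%:R * norm2 (z T - z 0%N).
Proof.
move=> lambda xbar; have T0 : (T%:R : R) != 0 by rewrite pnatr_eq0 -lt0n.
have Yy := dual_subgradient_Y algo.
split; last first.
  move=> j; apply: le_trans (lipschitz_average Y_convex hullX_sub_Y V_gt0 algo
    T_gt0 (g_lipschitz j)) _; rewrite lerD2r.
  apply: le_trans (jensen_average Y_convex (g_convex j) Yy T_gt0) _.
  apply: le_trans (average_le (q := fun t => V * w t.+1 0 j - V * w t 0 j) T _) _.
    by move=> t /=; rewrite -mulrBr (multiplier_step V_gt0 algo).
  (* The telescoped sum is [V / T%:R] times the signed change of [w] in coordinate [j], which its
     absolute value dominates. *)
  rewrite (average_telescope T (fun t => V * w t 0 j : R^o)) -mulrBr.
  rewrite /GRing.scale/= mulrA [_^-1 * _]mulrC ler_wpM2l ?ler_norm//.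
  by rewrite divr_ge0 ?(ltW V_gt0).
(* It suffices to bound every feasible value from below, provided there is one: the Slater point is
   feasible, which rules out the default value of [inf] on the empty set. *)
rewrite lerBlDr -lerBlDl; apply: lb_le_inf.
  have [u [Xu _ gu]] := slater.
  by exists (f u), u => //; split=> // j; exact: ltW.
move=> _ [u u_feasible <-]; rewrite lerBlDl.
apply: le_trans (lipschitz_average Y_convex hullX_sub_Y V_gt0 algo
  T_gt0 f_lipschitz) _.
rewrite addrAC lerD2r.
apply: le_trans (jensen_average Y_convex f_convex Yy T_gt0) _.
pose L t := norm2 (lambda t) ^+ 2.
(* [F] is chosen so that its increments are exactly the right-hand side of [drift_plus_penalty]; the
   averaged bound then telescopes. *)
pose F t : R^o := t%:R * (f u + C / V) - V / 2 * L t.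
apply: le_trans (average_le (q := fun t => F t.+1 - F t) T _) _.
  move=> t /=; apply: le_trans (drift_plus_penalty hullX_sub_Y V_gt0 algo
    g_bound diff_bound t u_feasible) _.
  by rewrite /F /L -natr1; apply: eq_ler; ring.
rewrite average_telescope /F /GRing.scale/= -/(L 0%N) -/(L T).
apply: eq_ler; field.
by rewrite T0 gt_eqF.
Qed.
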